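(* Let $X\subseteq 2^\omega$. The following are equivalent: (a) $X$ contains no perfect subset (a set $C\subseteq X$ is perfect if it is non-empty, closed in $2^\omega$, and has no isolated points); (b) the almost disjoint family of branches $\mathcal A_X$ is semi-proximal; (c) $\mathcal A_X$ is totally semi-proximal.
   Context: Branching families: for $x\in 2^\omega$ let $a_x=\{x|n : n\in\omega\}\subseteq 2^{<\omega}$, and for $X\subseteq 2^\omega$ let $\mathcal A_X=\{a_x : x\in X\}$. This is an almost disjoint family on the countable set $2^{<\omega}$. ($2^\omega$ carries the product topology.) An almost disjoint family on an infinite countable set $N$ is a collection $\mathcal A$ of infinite subsets of $N$ any two distinct members of which have finite intersection. Its $\Psi$-space $\Psi(\mathcal A)$ is the (disjoint) union $N\cup\mathcal A$, topologized so that $N$ is open and discrete and, for $a\in\mathcal A$, the sets $\{a\}\cup (a\setminus F)$, $F\subseteq N$ finite, form a local basis at $a$. Proximal game on a uniform space $(Z,\mathbb U)$: for an entourage $U$ write $U[x]=\{y\in Z : (x,y)\in U\}$. At inning $0$ Player I plays $U_0\in\mathbb U$ and Player II plays $x_0\in Z$; at inning $n+1$ Player I plays $U_{n+1}\in\mathbb U$ with $U_{n+1}\subseteq U_n$ and Player II plays $x_{n+1}\in U_n[x_n]$. Player I wins if $(x_n)_{n\in\omega}$ converges in the topology induced by $\mathbb U$ or $\bigcap_{n\in\omega}U_n[x_n]=\emptyset$; otherwise Player II wins. $(Z,\mathbb U)$ is semi-proximal if Player II has no winning strategy. A strategy for Player II assigns a legal move to each finite sequence of moves of Player I; it is winning if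 Player II wins every run following it. A topological space is semi-proximal if there is a uniformity $\mathbb U$ inducing its topology for which the uniform space is semi-proximal; it is totally semi-proximal if such a $\mathbb U$ can additionally be chosen totally bounded (for every $U\in\mathbb U$ there is a finite $F$ with $Z=\bigcup_{x\in F}U[x]$). An almost disjoint family is called (totally) semi-proximal if its $\Psi$-space is. *)

(* Defs.v *)
From HB Require Import structures.
From mathcomp Require Export all_boot.
From mathcomp Require Export boolp classical_sets functions cardinality filter.
From mathcomp Require Export topology cantor.

Set Implicit Arguments.
Unset Strict Implicit.
Unset Printing Implicit Defensive.

Local Open Scope classical_set_scope.

Definition almost_disjoint (N : Type) (A : set (set N)) : Prop :=
  (forall a, A a -> infinite_set a) /\
  (forall a b, A a -> A b -> a <> b -> finite_set (a `&` b)).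

Definition Psi (N : Type) (A : set (set N)) : Type := (N + set_type A)%type.

Section PsiTopology.
Variables (N : Type) (A : set (set N)).

Definition psi_basic (a : set_type A) (F : set N) : set (Psi A) :=
  [set inr a] `|` [set inl n | n in val a `\` F].

Definition psi_nbhs (z : Psi A) : set_system (Psi A) :=
  match z with
  | inl n => principal_filter (inl n : Psi A)
  | inr a => filter_from [set F : set N | finite_set F] (psi_basic a)
  end.

HB.instance Definition _ := gen_eqMixin (Psi A).
HB.instance Definition _ := gen_choiceMixin (Psi A).
HB.instance Definition _ := hasNbhs.Build (Psi A) psi_nbhs.

Let psi_nbhs_filter (z : Psi A) : ProperFilter (nbhs z).
Proof.
case: z => [n|a]; first exact: principal_filter_proper.
apply: filter_from_proper; last by move=> F _; exists (inr a); left.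
apply: filter_from_filter; first by exists set0; exact: finite_set0.
move=> F G finF finG; exists (F `|` G); first by rewrite /= finite_setU.
move=> z [->|[n [an nFG] <-]]; first by split; left.
by split; right; exists n => //; split=> // ?; apply: nFG; [left|right].
Qed.

Let psi_nbhs_singleton (z : Psi A) (W : set (Psi A)) : nbhs z W -> W z.
Proof.
by case: z => [n /principal_filterP|a [F _ aFW]] //; apply: aFW; left.
Qed.

Let psi_nbhs_nbhs (z : Psi A) (W : set (Psi A)) :
  nbhs z W -> nbhs z (nbhs^~ W).
Proof.
case: z => [n Wn|a [F finF aFW]]; first exact/principal_filterP.
exists F => // z [->|[n anF <-]]; first by exists F.
by apply/principal_filterP/aFW; right; exists n.
Qed.

HB.instance Definition _ := Nbhs_isNbhsTopological.Build (Psi A)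
  psi_nbhs_filter psi_nbhs_singleton psi_nbhs_nbhs.

End PsiTopology.

Section ProximalGame.
Variable Z : uniformType.
Implicit Types (U : nat -> set (Z * Z)) (s : seq (set (Z * Z))).

Definition legal_position s : Prop :=
  (forall i, i < size s -> entourage (nth setT s i)) /\
  (forall i, i.+1 < size s -> nth setT s i.+1 `<=` nth setT s i).

Definition legal_play U : Prop :=
  (forall n, entourage (U n)) /\ (forall n, U n.+1 `<=` U n).

(* [sigma [:: U_0; ...; U_n]] is the answer x_n of Player II to U_0, ..., U_n;
   x_0 is unconstrained, and x_{n+1} must lie in U_n[x_n]. *)
Definition strategyII (sigma : seq (set (Z * Z)) -> Z) : Prop :=
  forall s E E', legal_position (rcons (rcons s E) E') ->
    xsection E (sigma (rcons s E)) (sigma (rcons (rcons s E) E')).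

Definition playerI_wins U (x : nat -> Z) : Prop :=
  (exists l : Z, x @ \oo --> l) \/ \bigcap_n xsection (U n) (x n) = set0.

Definition winning_strategyII (sigma : seq (set (Z * Z)) -> Z) : Prop :=
  strategyII sigma /\
  forall U, legal_play U -> ~ playerI_wins U (fun n => sigma (mkseq U n.+1)).

Definition semi_proximal_uniform : Prop :=
  ~ exists sigma, winning_strategyII sigma.

Definition totally_bounded : Prop :=
  forall E : set (Z * Z), entourage E ->
    exists2 F : set Z, finite_set F & \bigcup_(x in F) xsection E x = setT.

End ProximalGame.

(* [Nbhs_isUniform_mixin T] is the type of the uniformities on [T] that induce
   the given topology of [T]: its last field states [nbhs = nbhs_ entourage]. *)
Definition with_uniformity (T : topologicalType)
  (U : Nbhs_isUniform_mixin T) : uniformType := HB.pack (Topological.sort T) U.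

Definition semi_proximal_space (T : topologicalType) : Prop :=
  exists U : Nbhs_isUniform_mixin T, semi_proximal_uniform (with_uniformity U).

Definition totally_semi_proximal_space (T : topologicalType) : Prop :=
  exists U : Nbhs_isUniform_mixin T,
    totally_bounded (with_uniformity U) /\
    semi_proximal_uniform (with_uniformity U).

Definition semi_proximal (N : Type) (A : set (set N)) : Prop :=
  semi_proximal_space (Psi A).

Definition totally_semi_proximal (N : Type) (A : set (set N)) : Prop :=
  totally_semi_proximal_space (Psi A).

Definition branch (x : cantor_space) : set (seq bool) :=
  [set mkseq x n | n in [set: nat]].

Definition branches (X : set cantor_space) : set (set (seq bool)) :=
  [set branch x | x in X].

Lemma branches_almost_disjoint (X : set cantor_space) :
  almost_disjoint (branches X).
Proof.
split=> [_ [x _ <-]|_ _ [x _ <-] [y _ <-] xNy].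
  have inj_x : {in [set: nat] &, injective (mkseq x)}.
    by move=> m n _ _ /(congr1 size); rewrite !size_mkseq.
  by rewrite (eq_finite_set (inj_card_eq inj_x)); exact: infinite_nat.
have [n xyn] : exists n, x n <> y n.
  by apply/existsNP => xy; apply: xNy; congr branch; exact/funext.
apply: (@sub_finite_set _ _ (mkseq x @` `I_n.+1)); last first.
  exact/finite_image/finite_II.
move=> _ [[m _ <-] [k _ yxk]]; exists m => //=; rewrite ltnNge.
apply/negP => nm; apply: xyn.
have km : k = m by have := congr1 size yxk; rewrite !size_mkseq.
by rewrite -(nth_mkseq false x nm) -yxk km nth_mkseq.
Qed.

(* Main.v *)
Require Import Defs.

(** From a perfect set [C] inside [X], Player II wins for every uniformity:
    every branch of [C] converges to its point of the Psi-space, so a category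
    argument finds, for each entourage and each node of the tree of [C], a node
    above it whose whole cone (nodes and branches of [C]) is small. Player II
    plays nodes in shrinking small cones, each one off the branch [b] that the
    cones converge to: [b] then belongs to all the sets [U_n[x_n]], but the
    play does not converge to it.

    If [X] contains no perfect set, take the totally bounded uniformity of all
    finite clopen partitions. Given a winning strategy of Player II, let
    Player I separate more and more nodes; every such run then ends at a branch
    of [X]. From any position Player I can also isolate the branch where the
    current run ends, and Player II must escape to a different one. Iterating
    gives a Cantor scheme of positions, whose runs end at a perfect set of
    branches of [X]. *)

Set Implicit Arguments.
Unset Strict Implicit.
Unset Printing Implicit Defensive.

Local Open Scope classical_set_scope.

(** * Branches of the Cantor space *)

Lemma eq_mkseqP (T : Type) (x y : nat -> T) n :
  mkseq x n = mkseq y n <-> forall i, i < n -> x i = y i.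
Proof.
split=> [xy i ni|xy].
  by rewrite -(nth_mkseq (x i) x ni) xy nth_mkseq.
by apply/eq_in_map => i; rewrite mem_iota => /andP[_]; exact: xy.
Qed.

Lemma prefix_mkseq (T : eqType) (x : nat -> T) p n :
  prefix p (mkseq x n) = (size p <= n) && (p == mkseq x (size p)).
Proof.
have [pn|np] /= := leqP (size p) n; last first.
  by apply/negP => /size_prefix; rewrite size_mkseq leqNgt np.
by rewrite prefixE /mkseq -map_take take_iota (minn_idPl pn) eq_sym.
Qed.

Lemma nbhs_cantorP (x : cantor_space) (W : set cantor_space) :
  nbhs x W <-> exists n, [set y | mkseq y n = mkseq x n] `<=` W.
Proof.
pose F := filter_from [set: nat]
  (fun n => [set y : cantor_space | mkseq y n = mkseq x n]).
have FF : Filter F.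
  apply: filter_from_filter; first by exists 0.
  move=> m n _ _; exists (maxn m n) => //= y /eq_mkseqP yx.
  by split; apply/eq_mkseqP => i ni; apply: yx; rewrite leq_max ni ?orbT.
split=> [Wx|[n nW]]; last first.
  apply: filterS nW _.
  suff : \forall y \near x, forall i : 'I_n, (y : nat -> bool) i = x i.
    apply: filterS => y xy; apply/eq_mkseqP => i ni.
    exact: (xy (Ordinal ni)).
  pose same (i : 'I_n) := [set y : cantor_space | y i = x i].
  apply: (@filter_forall _ _ same (nbhs x)) => i.
  have := @proj_continuous nat (fun=> bool) i x [set x i].
  by apply; exact: discrete_set1.
suff /(_ W Wx)[n _ nW] : F --> x by exists n.
apply/cvg_sup => i U [V] [[B] oB <-] Bxi BU.
exists i.+1 => // y /eq_mkseqP yx; apply: BU.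
by rewrite /= yx.
Qed.

Lemma branch_mkseq (x : cantor_space) n : branch x (mkseq x n).
Proof. by exists n. Qed.

Lemma branchE (x : cantor_space) p : branch x p -> p = mkseq x (size p).
Proof. by case=> n _ <-; rewrite size_mkseq. Qed.

(** Since [n <= m n], bit [i] no longer changes from stage [i.+1] on. The diagonal is therefore the
    limit of the [y n], and closedness puts it in [C]. *)
Lemma fusion (C : set cantor_space) (y : nat -> cantor_space) (m : nat -> nat) :
  closed C -> (forall n, C (y n)) -> (forall n, m n < m n.+1) ->
  (forall n, mkseq (y n.+1) (m n) = mkseq (y n) (m n)) ->
  exists2 b, C b & forall n, mkseq b (m n) = mkseq (y n) (m n).
Proof.
move=> clC Cy mS yS; have m_mono : {homo m : i j / i <= j}.
  by apply: homo_leq => [//|j i k|i]; [exact: leq_trans|exact: ltnW].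
have le_m n : n <= m n by elim: n => // n /leq_ltn_trans; apply.
have y_mono n k : n <= k -> mkseq (y k) (m n) = mkseq (y n) (m n).
  elim: k => [|k IH]; first by rewrite leqn0 => /eqP ->.
  rewrite leq_eqVlt => /predU1P[->//|nk]; rewrite -(IH nk).
  apply/eq_mkseqP => i im; move: i {im}(leq_trans im (m_mono n k nk)).
  by apply/eq_mkseqP.
pose b : cantor_space := fun i => y i.+1 i.
have by_ n : mkseq b (m n) = mkseq (y n) (m n).
  apply/eq_mkseqP => i im; rewrite /b; have [ni|ni] := leqP n i.+1.
    by have /eq_mkseqP -> := y_mono _ _ ni.
  by have /eq_mkseqP -> // := y_mono _ _ (ltnW ni); exact: le_m.
exists b => //; apply: clC => W /nbhs_cantorP[n nW].
exists (y n); split=> //; apply: nW => /=; apply/eq_mkseqP => i ni.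
by have /eq_mkseqP <- // := by_ n; exact: leq_trans (le_m n).
Qed.

(** * The uniformity of finite clopen partitions *)

Section ClopenUniformity.
Variable T : topologicalType.

Definition locally_constant (S : Type) (h : T -> S) : Prop :=
  forall z, \forall w \near z, h w = h z.

(* The fibers of such an [h] are the cells of a finite clopen partition. *)
Definition fin_entourage : set_system (T * T) :=
  [set E | exists (I : finType) (h : T -> I),
     locally_constant h /\ forall u v, h u = h v -> E (u, v)].

Lemma fin_entourage_filter : Filter fin_entourage.
Proof.
split.
- by exists unit, (fun=> tt); split=> // z; exact: nearW.
- move=> E F [I [h [hlc hE]]] [J [k [klc kF]]].
  exists (I * J)%type, (fun z => (h z, k z)); split=> [z|u v [/hE ? /kF ?]] //.
  by apply: filterS2 (hlc z) (klc z) => w -> ->.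
- move=> E F EF [I [h [hlc hE]]]; exists I, h; split=> // u v /hE; exact: EF.
Qed.

Lemma fin_entourage_diagonal E : fin_entourage E -> diagonal `<=` E.
Proof. by move=> [I [h [_ hE]]] [u v] uv; apply: hE; congr h. Qed.

Lemma fin_entourage_inv E : fin_entourage E -> fin_entourage E^-1%relation.
Proof.
by move=> [I [h [hlc hE]]]; exists I, h; split=> // u v /esym /hE.
Qed.

Lemma fin_entourage_split E : fin_entourage E ->
  exists2 F, fin_entourage F & (F \; F)%relation `<=` E.
Proof.
move=> [I [h [hlc hE]]]; exists [set uv | h uv.1 = h uv.2].
  by exists I, h.
by move=> [u v] [w /= uw wv]; apply: hE; exact: etrans wv.
Qed.

Hypothesis clopen_base : forall z (W : set T), nbhs z W ->
  exists S : set T, [/\ clopen S, S z & S `<=` W].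

Lemma locally_constant_clopen (S : set T) :
  clopen S -> locally_constant (fun z => `[< S z >]).
Proof.
move=> [oS /closed_openC oSC] z; have [Sz|NSz] := pselect (S z).
  have : nbhs z S by apply: open_nbhs_nbhs.
  by apply: filterS => w Sw; rewrite !asboolT.
have : nbhs z (~` S) by apply: open_nbhs_nbhs.
by apply: filterS => w NSw; rewrite !asboolF.
Qed.

Lemma nbhs_fin_entourage : nbhs = nbhs_ fin_entourage.
Proof.
apply/funext => z; apply/seteqP; split=> W.
  move=> /clopen_base[S [clS Sz SW]].
  exists [set uv | `[< S uv.1 >] = `[< S uv.2 >]].
    exists bool, (fun u => `[< S u >]); split=> //.
    exact: locally_constant_clopen.
  by move=> w /xsectionP /= /esym; rewrite (asboolT Sz) => /asboolP; exact: SW.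
move=> [E [I [h [hlc hE]]] EW]; apply: filterS (hlc z) => w hw.
by apply/EW/xsectionP/hE.
Qed.

Definition fin_uniformity : Nbhs_isUniform_mixin T :=
  Nbhs_isUniform_mixin.Axioms_ fin_entourage fin_entourage_filter
    fin_entourage_diagonal fin_entourage_inv fin_entourage_split
    nbhs_fin_entourage.

Lemma fin_uniformity_totally_bounded :
  totally_bounded (with_uniformity fin_uniformity).
Proof.
move=> E [I [h [_ hE]]].
have [[z0]|T0] := pselect (inhabited T); last first.
  exists set0 => //; apply/seteqP; split=> // z _.
  by case: T0; exists.
have /choice[r hr] : forall i, exists x, (exists z, h z = i) -> h x = i.
  move=> i.
  have [[z hz]|Ni] := pselect (exists z, h z = i); first by exists z.
  by exists z0 => /Ni.
exists (range r); first exact/finite_image/finite_finset.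
apply/seteqP; split=> // z _; exists (r (h z)); first by exists (h z).
by apply/xsectionP/hE/hr; exists z.
Qed.
End ClopenUniformity.

(** * Playing as Player II inside a perfect set *)

Lemma legal_position_rcons (Z : uniformType) (s : seq (set (Z * Z))) E :
  legal_position (rcons s E) -> legal_position s /\ entourage E.
Proof.
move=> [ent dec]; split; last first.
  by have := ent (size s); rewrite nth_rcons ltnn eqxx size_rcons; apply.
split=> i i_s.
  have := ent i; rewrite nth_rcons i_s; apply.
  by rewrite size_rcons ltnS ltnW.
have := dec i; rewrite !nth_rcons i_s (ltnW i_s); apply.
by rewrite size_rcons ltnS ltnW.
Qed.

Lemma legal_position_mkseq (Z : uniformType) (U : nat -> set (Z * Z)) n :
  legal_play U -> legal_position (mkseq U n).
Proof.
move=> [entU decU]; split=> i; rewrite size_mkseq => ni.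
  by rewrite nth_mkseq.
by rewrite !nth_mkseq //; exact: ltnW.
Qed.

Section StrategyII.
Variables (Z : uniformType) (C : set cantor_space).
Variables (node : seq bool -> Z) (point : cantor_space -> Z).
Hypothesis node_cvg :
  forall x, C x -> (fun n => node (mkseq x n)) @ \oo --> point x.
Hypothesis closedC : closed C.
Hypothesis perfectC : isolated C = set0.

(** By category, some cone has a dense set of branches whose nodes from level [m] on are all close
    to their point. Each node of the cone lies on such a branch, so it is close, via that point, to
    the root of the cone. The points of the cone follow as limits of nodes. *)
Lemma close_cone E y n : entourage E -> C y ->
  exists z m, [/\ C z, n <= m, mkseq z n = mkseq y n &
    forall u, C u -> mkseq u m = mkseq z m -> forall k, m <= k ->
    forall v, C v -> mkseq v m = mkseq z m ->
      E (node (mkseq u k), point v) /\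
      forall l, m <= l -> E (node (mkseq u k), node (mkseq v l))].
Proof.
(* Four [W]-steps make an [E]-step, and two steps of the symmetric [V] make a [W]-step. *)
move=> entE Cy; pose W := split_ent (split_ent E).
pose V := split_ent W `&` (split_ent W)^-1%relation.
have entE' := entourage_split_ent entE.
have entW : entourage W := entourage_split_ent entE'.
have entV : entourage V := entourage_invI (entourage_split_ent entW).
pose near_point x m := forall k, m <= k -> V (point x, node (mkseq x k)).
have [z [m [Cz nm zy zdense]]] : exists z m, [/\ C z, n <= m,
    mkseq z n = mkseq y n &
    forall u, C u -> mkseq u m = mkseq z m -> forall k, m <= k ->
      exists v, [/\ C v, mkseq v k = mkseq u k & near_point v m]].
  (* Otherwise fusion yields a branch of [C] that is [near_point] at no
     level, contradicting the convergence of its nodes. *)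
  apply: contrapT => Nz.
  have step (r : cantor_space * nat) : exists r' : cantor_space * nat,
      C r.1 -> n <= r.2 -> mkseq r.1 n = mkseq y n ->
      [/\ C r'.1, r.2 < r'.2, mkseq r'.1 r.2 = mkseq r.1 r.2 &
        forall v, C v -> mkseq v r'.2 = mkseq r'.1 r'.2 -> ~ near_point v r.2].
    case: r => z m /=; apply: contrapT => Nr; apply: Nz; exists z, m.
    have [Cz|?] := pselect (C z); last by case: Nr; exists (z, m).
    have [nm|?] := pselect (n <= m); last by case: Nr; exists (z, m).
    have [zy|?] := pselect (mkseq z n = mkseq y n); last first.
      by case: Nr; exists (z, m).
    split=> // u Cu uz k mk; apply: contrapT => Nv; apply: Nr.
    (* [k.+1] rather than [k] makes the levels strictly increase, as [fusion] requires. *)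
    exists (u, k.+1) => _ _ _ /=; split=> // v Cv vu near_v; apply: Nv.
    exists v; split=> //; apply/eq_mkseqP => i ik.
    by move/eq_mkseqP: vu => -> //; exact: ltnW.
  have {step} [f fP] := choice step.
  pose r i := iter i f (y, n).
  have rP i : [/\ C (r i).1, n <= (r i).2 & mkseq (r i).1 n = mkseq y n].
    elim: i => [//|i [Cr nr ry]]; have [Cr' lt_r r'r _] := fP _ Cr nr ry.
    split=> //; first exact: leq_trans (ltnW lt_r).
    rewrite -ry; apply/eq_mkseqP => j jn.
    by move/eq_mkseqP: r'r => -> //; exact: leq_trans nr.
  have rS i : [/\ C (r i.+1).1, (r i).2 < (r i.+1).2,
      mkseq (r i.+1).1 (r i).2 = mkseq (r i).1 (r i).2 &
      forall v, C v -> mkseq v (r i.+1).2 = mkseq (r i.+1).1 (r i.+1).2 ->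
      ~ near_point v (r i).2].
    by have [Cr nr ry] := rP i; exact: fP.
  have [||||b Cb br] := @fusion C (fun i => (r i).1) (fun i => (r i).2).
  - exact: closedC.
  - by move=> i; case: (rP i).
  - by move=> i; case: (rS i).
  - by move=> i; case: (rS i).
  have [N _ NV] := cvg_entourage (node_cvg Cb) entV.
  have le_r i : i <= (r i).2.
    by elim: i => // i /leq_ltn_trans; apply; case: (rS i).
  have [_ _ _ /(_ b Cb (br _))] := rS N; apply=> k rk.
  by apply: NV; exact: leq_trans rk.
exists z, m; split=> // u Cu uz k mk v Cv vz.
have common w l : C w -> mkseq w m = mkseq z m -> m <= l ->
    W (node (mkseq z m), node (mkseq w l)) /\
    W (node (mkseq w l), node (mkseq z m)).
  move=> Cw wz ml; have [x [Cx xw near_x]] := zdense w Cw wz l ml.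
  have xz : mkseq x m = mkseq z m.
    rewrite -wz; apply/eq_mkseqP => i im.
    by move/eq_mkseqP: xw => -> //; exact: leq_trans ml.
  have := near_x l ml; have := near_x m (leqnn m); rewrite xw xz.
  move=> [Vxz /= Vzx] [Vxw /= Vwx].
  by split; apply: (entourage_split (point x)).
have close l : m <= l ->
    split_ent E (node (mkseq u k), node (mkseq v l)).
  move=> ml; have [_ Wuz] := common u k Cu uz mk.
  have [Wzv _] := common v l Cv vz ml.
  by apply: (entourage_split (node (mkseq z m))).
split=> [|l ml]; last by apply: split_ent_subset => //; exact: close.
have [N _ NV] := cvg_entourage (node_cvg Cv) entV.
pose l := maxn m N; have := NV l (leq_maxr _ _).
move=> [_ /= Wlv]; apply: (entourage_split (node (mkseq v l))) => //.
  by apply: close; exact: leq_maxl.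
by do 2 apply: split_ent_subset => //.
Qed.

Lemma perfect_split x n : C x ->
  exists w m, [/\ C w, n < m, mkseq w n = mkseq x n & mkseq w m <> mkseq x m].
Proof.
move=> Cx; have [w [Cw wx wNx]] :
    exists w, [/\ C w, mkseq w n = mkseq x n & w <> x].
  apply: contrapT => Nw; suff : isolated C x by rewrite perfectC.
  split; first exact/mem_set.
  exists [set w | mkseq w n = mkseq x n]; first by apply/nbhs_cantorP; exists n.
  apply/seteqP; split=> [w [wx Cw]|w ->] //.
  by apply: contrapT => wNx; apply: Nw; exists w.
have [j wxj] : exists j, w j <> x j.
  by apply/existsNP => wx'; apply: wNx; exact/funext.
exists w, j.+1; split=> // [|/eq_mkseqP /(_ j (ltnSn j))//].
by rewrite ltnS leqNgt; apply/negP => jn; apply: wxj; move/eq_mkseqP: wx; exact.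
Qed.

(* Player II holds [((x, n), p)]: the play ends in the cone of [mkseq x n],
   and the last point played is [node p]. *)
Let state := (cantor_space * nat * seq bool)%type.

(** The node [p] lies in the old cone, so the closeness secured one inning earlier makes it a legal
    move. It is off every branch of the new cone, yet [E]-close to all their points: this keeps the
    limit branch in [U_n[x_n]]. *)
Let answer E (xn : cantor_space * nat) (r : state) : Prop :=
  let: (y, m, p) := r in
  [/\ C y, xn.2 < m, mkseq y xn.2 = mkseq xn.1 xn.2 &
  [/\ exists w, [/\ C w, mkseq w xn.2 = mkseq xn.1 xn.2 & p = mkseq w m],
      p <> mkseq y m &
      forall v, C v -> mkseq v m = mkseq y m ->
        E (node p, point v) /\
        forall l, m <= l -> E (node p, node (mkseq v l))]].

Lemma answer_ex E xn : exists r, entourage E -> C xn.1 -> answer E xn r.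
Proof.
case: xn => x n /=; have [entE|] := pselect (entourage E); last first.
  by exists (x, n, [::]).
have [Cx|] := pselect (C x); last by exists (x, n, [::]).
have [z [k [Cz nk zx zclose]]] := close_cone n entE Cx.
(* Inside the small cone of level [k], a later splitting gives two distinct nodes of level [m]: one
   is played, the other is the root of the new cone. *)
have [w [m [Cw km wz wNz]]] := perfect_split k Cz.
exists (z, m, mkseq w m) => _ _; split=> //; first exact: leq_ltn_trans km.
have low u j : n <= j -> mkseq u j = mkseq z j -> mkseq u n = mkseq x n.
  move=> nj /eq_mkseqP uz; rewrite -zx; apply/eq_mkseqP => i ni.
  by rewrite uz // (leq_trans ni).
split=> //; first by exists w; split=> //; exact: low wz.
move=> v Cv vz; have vz' : mkseq v k = mkseq z k.
  apply/eq_mkseqP => i ik; move/eq_mkseqP: vz => -> //.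
  exact: ltn_trans km.
have [Ewv Ewvl] := zclose w Cw wz m (ltnW km) v Cv vz'.
by split=> // l ml; apply: Ewvl; exact: leq_trans (ltnW km) ml.
Qed.

Lemma strategyII_ex : C !=set0 ->
  exists2 sigma : seq (set (Z * Z)) -> Z, strategyII sigma &
  forall U, legal_play U -> exists (b : cantor_space) (p : nat -> seq bool),
    [/\ C b, forall n, sigma (mkseq U n.+1) = node (p n),
      forall n, U n (node (p n), point b) &
      forall n, [/\ n < size (p n), p n <> mkseq b (size (p n)) &
        take n (p n) = mkseq b n]].
Proof.
move=> [x0 Cx0].
have /choice[f fP] : forall Exn, exists r,
    entourage Exn.1 -> C Exn.2.1 -> answer Exn.1 Exn.2 r.
  by case=> E xn; exact: answer_ex.
(* The initial cone is the whole tree. The node [[::]] is a placeholder, as every answer in a play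
   follows a nonempty position. *)
pose st s : state := foldl (fun r E => f (E, r.1)) ((x0, 0), [::]) s.
have stS s E : st (rcons s E) = f (E, (st s).1) by rewrite /st foldl_rcons.
have Cst s : legal_position s -> C (st s).1.1.
  elim/last_ind: s => // s E IH /legal_position_rcons[/IH Cs entE].
  by rewrite stS; have := fP (E, (st s).1) entE Cs; case: (f _) => [[y m] p] [].
have stP s E : legal_position (rcons s E) ->
    answer E (st s).1 (st (rcons s E)).
  move=> /legal_position_rcons[/Cst Cs entE]; rewrite stS.
  exact: (fP (E, (st s).1)).
exists (fun s => node (st s).2).
  move=> s E E' legal; have [legal' _] := legal_position_rcons legal.
  apply/xsectionP; have := stP _ _ legal; have := stP _ _ legal'.
  case: (st (rcons s E)) => [[y m] p] [_ _ _ [_ _ close]].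
  case: (st _) => [[y' m'] p'] [_ mm' _ [[w [Cw wy ->]] _ _]] /=.
  by have [_] := close w Cw wy; apply; exact: ltnW.
move=> U legalU; pose r n := st (mkseq U n).
have rP n : answer (U n) (r n).1 (r n.+1).
  rewrite /r mkseqS; apply: stP; rewrite -mkseqS.
  exact: legal_position_mkseq.
have rP' n : [/\ C (r n.+1).1.1, (r n).1.2 < (r n.+1).1.2,
    mkseq (r n.+1).1.1 (r n).1.2 = mkseq (r n).1.1 (r n).1.2 &
    [/\ exists w, [/\ C w, mkseq w (r n).1.2 = mkseq (r n).1.1 (r n).1.2
           & (r n.+1).2 = mkseq w (r n.+1).1.2],
      (r n.+1).2 <> mkseq (r n.+1).1.1 (r n.+1).1.2 &
      forall v, C v -> mkseq v (r n.+1).1.2 = mkseq (r n.+1).1.1 (r n.+1).1.2 ->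
        U n (node (r n.+1).2, point v)]].
  have := rP n; case: (r n.+1) => [[y m] p] [Cy nm yx [wP pNy close]] /=.
  by split=> //; split=> // v Cv vy; case: (close v Cv vy).
have [||||b Cb br] := @fusion C (fun n => (r n).1.1) (fun n => (r n).1.2).
- exact: closedC.
- by case=> [|n] //; case: (rP' n).
- by move=> n; case: (rP' n).
- by move=> n; case: (rP' n).
have sz n : size (r n.+1).2 = (r n.+1).1.2.
  by have [_ _ _ [[w [_ _ ->]] _ _]] := rP' n; rewrite size_mkseq.
have le_r n : n <= (r n).1.2.
  by elim: n => // n /leq_ltn_trans; apply; case: (rP' n).
exists b, (fun n => (r n.+1).2); split=> // n.
  by have [_ _ _ [_ _ +]] := rP' n; apply=> //; exact: br.
have [_ lt_r _ [[w [Cw wr wE]] pN _]] := rP' n.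
rewrite sz; split; first exact: le_r.
  by move=> pE; apply: pN; rewrite pE br.
(* The node played extends the root of the previous cone, which lies on [b] and has level at least
   [n]. *)
rewrite wE /mkseq -map_take take_iota (minn_idPl (ltnW (le_r n.+1))).
apply/eq_mkseqP => i /leq_trans/(_ (le_r n)) ir.
by move/eq_mkseqP: wr => -> //; move/eq_mkseqP: (br n) => ->.
Qed.

End StrategyII.

(** * A perfect set of outcomes *)

Lemma range_cantor_perfect (g : cantor_space -> cantor_space) :
  injective g -> continuous g ->
  [/\ range g !=set0, closed (range g) & isolated (range g) = set0].
Proof.
move=> g_inj g_cont; split; first by exists (g (fun=> false)), (fun=> false).
  apply: compact_closed; first exact: cantor_space_hausdorff.
  apply: continuous_compact cantor_space_compact.
  exact: continuous_subspaceT.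
apply/seteqP; split=> // _ [/set_mem[b _ <-] [V nV Vg]].
have /nbhs_cantorP[n nb] : nbhs b (g @^-1` V) by exact: g_cont.
(* Flipping bit [n] of [b] keeps its first [n] bits, so [g c] is a second point of the range in
   [V]. *)
pose c : cantor_space := fun i => if i == n then ~~ b n else b i.
have /seteqP[/(_ (g c)) + _] := Vg.
have Vgc : V (g c).
  by apply: (nb c); apply/eq_mkseqP => i ni; rewrite /c ltn_eqF.
move=> /(_ (conj Vgc (ex_intro2 _ _ c I erefl))) /g_inj/(congr1 (@^~ n)).
by rewrite /c eqxx; case: (b n).
Qed.

Section PlayerI.
Variables (Z : uniformType) (X : set cantor_space).
Variables (point : cantor_space -> Z) (E : nat -> set (Z * Z)).
Hypothesis legalE : legal_play E.
Hypothesis limit_point_of : forall (x : nat -> Z) z,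
  (forall n, E n (x n, z)) -> ~ (exists l : Z, x @ \oo --> l) ->
  exists2 a, X a & z = point a.
Hypothesis isolating : forall a, X a -> exists2 B, entourage B &
  forall x : nat -> Z, (forall n, E n (x n, point a)) ->
    (\forall n \near \oo, B (x n, point a)) -> x @ \oo --> point a.
Hypothesis separating : forall n z a b, X a -> X b ->
  E n (z, point a) -> E n (z, point b) -> mkseq a n = mkseq b n.
Variable sigma : seq (set (Z * Z)) -> Z.
Hypothesis winning : winning_strategyII sigma.

Let play (U : nat -> set (Z * Z)) n := sigma (mkseq U n.+1).

Let fine_play U := legal_play U /\ forall n, U n `<=` E n.

Let outcome U a := X a /\ forall n, U n (play U n, point a).

(** A run won by Player II does not converge and has a point in all [U_n[x_n]]; [limit_point_of]
    identifies it with a branch of [X]. *)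
Lemma outcome_ex U : fine_play U -> exists a, outcome U a.
Proof.
move=> [legalU UE]; have [_ /(_ U legalU)] := winning.
move=> /not_orP[ncvg /eqP/set0P[z zU]].
have Uz n : U n (play U n, z) by have /xsectionP := zU n I.
have [|a Xa za] := limit_point_of (x := play U) (z := z) _ ncvg.
  by move=> n; exact: UE.
by exists a; split=> // n; rewrite -za.
Qed.

(** From inning [N] on, Player I also intersects with the [B] that isolates [a]. If the run ended at
    [a] again, it would converge to [point a] and Player II would lose. *)
Lemma outcome_other U N a : fine_play U -> outcome U a ->
  exists V b, [/\ fine_play V, forall i, i < N -> V i = U i, outcome V b
    & b <> a].
Proof.
move=> [[entU decU] UE] [Xa Ua]; have [B entB Bcvg] := isolating Xa.
pose V i := if i < N then U i else U i `&` B.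
have fineV : fine_play V.
  split; last first.
    move=> n; apply: subset_trans (UE n).
    by rewrite /V; case: ifP => _ // x [].
  split=> n; first by rewrite /V; case: ifP => // _; exact: filterI.
  rewrite /V; have [n1N|Nn1] := ltnP n.+1 N.
    by rewrite (ltnW n1N); exact: decU.
  case: ifP => _; first by apply: subset_trans (decU n); exact: subIsetl.
  by apply: setSI; exact: decU.
have [b [Xb Vb]] := outcome_ex fineV.
exists V, b; split=> // [i iN|ba]; first by rewrite /V iN.
have [legalV VE] := fineV.
have [_ /(_ V legalV)] := winning; apply; left; exists (point a).
apply: Bcvg => [n|]; first by rewrite -ba; exact: VE.
by exists N => // n /= Nn; have := Vb n; rewrite /V ltnNge Nn ba => -[].
Qed.

(** Take two runs with different outcomes that agree before [N]. By [separating], a single answer of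
    Player II fixes an initial segment of the outcome, so all continuations of long enough positions
    stay apart. *)
Lemma fine_play_split U N : fine_play U -> exists V0 V1 M,
  [/\ N < M, fine_play V0 /\ fine_play V1,
    forall i, i < N -> V0 i = U i /\ V1 i = U i &
    forall W0 W1 a0 a1, (forall i, i < M -> W0 i = V0 i) ->
      (forall i, i < M -> W1 i = V1 i) -> fine_play W0 -> fine_play W1 ->
      outcome W0 a0 -> outcome W1 a1 -> a0 <> a1].
Proof.
move=> fineU; have [a out_a] := outcome_ex fineU.
have [V [b [fineV VU out_b bNa]]] := outcome_other N fineU out_a.
have [j abj] : exists j, b j <> a j.
  by apply/existsNP => ba; apply: bNa; exact/funext.
(* [M] exceeds [j], so [M] bits show the difference. They are fixed by the answer at inning [M],
   which depends on [M.+1] moves: hence the witness [M.+1]. *)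
pose M := maxn N j.+1.
have determined W U' c d : fine_play W -> fine_play U' ->
    (forall i, i < M.+1 -> W i = U' i) ->
    outcome W c -> outcome U' d -> mkseq c M = mkseq d M.
  move=> [_ WE] [_ UE] WU [Xc Wc] [Xd Ud].
  apply: (separating (z := play U' M)) => //; last exact: UE.
  have <- : play W M = play U' M by congr sigma; exact/eq_mkseqP.
  exact: WE.
exists U, V, M.+1; split=> // [|i iN|]; first by rewrite ltnS leq_maxl.
  by rewrite VU.
move=> W0 W1 a0 a1 W0U W1V fine0 fine1 out0 out1 a01; apply: abj.
have /eq_mkseqP aE := determined _ _ _ _ fine0 fineU W0U out0 out_a.
have /eq_mkseqP bE := determined _ _ _ _ fine1 fineV W1V out1 out_b.
have jM : j < M by rewrite leq_maxr.
by rewrite -aE // -bE // a01.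
Qed.

(** The splittings form a Cantor scheme of positions. Sending [c] to an outcome of the run along [c]
    is injective by the splittings and continuous by [separating]; its range is the perfect set. *)
Lemma perfect_outcomes : exists C : set cantor_space,
  [/\ C `<=` X, C !=set0, closed C & isolated C = set0].
Proof.
pose run := nat -> set (Z * Z).
have /choice[f fP] : forall UN : run * nat, exists r : run * run * nat,
    fine_play UN.1 -> [/\ UN.2 < r.2, forall d : bool,
      let V := if d then r.1.2 else r.1.1 in
      fine_play V /\ (forall i, i < UN.2 -> V i = UN.1 i) &
    forall W0 W1 a0 a1, (forall i, i < r.2 -> W0 i = r.1.1 i) ->
      (forall i, i < r.2 -> W1 i = r.1.2 i) -> fine_play W0 -> fine_play W1 ->
      outcome W0 a0 -> outcome W1 a1 -> a0 <> a1].
  move=> [U N]; have [fineU|] := pselect (fine_play U); last first.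
    by exists (U, U, N).
  have [V0 [V1 [M [NM [fine0 fine1] VU sep]]]] := fine_play_split N fineU.
  by exists (V0, V1, M) => _; split=> // -[]; split=> // i /VU[].
(* [(r c n).2] counts the moves committed at stage [n]; the root is the play [E] with none
   committed. *)
pose fix r (c : cantor_space) n : run * nat := if n is n'.+1 then
  let q := f (r c n') in (if c n' then q.1.2 else q.1.1, q.2) else (E, 0).
have fine_r c n : fine_play (r c n).1.
  elim: n => [|n IH]; first by split=> // n x.
  have [_ + _] := fP _ IH.
  by move=> /(_ (c n))[].
have rS c n : (r c n).2 < (r c n.+1).2 /\
    forall i, i < (r c n).2 -> (r c n.+1).1 i = (r c n).1 i.
  by have [lt_r /(_ (c n))[_ agree] _] := fP _ (fine_r c n).
have r_le c n k i : n <= k -> i < (r c n).2 -> (r c k).1 i = (r c n).1 i.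
  move=> + ir; elim: k => [|k IH]; first by rewrite leqn0 => /eqP ->.
  rewrite leq_eqVlt => /predU1P[->//|nk]; rewrite -(IH nk).
  have [_ ->//] := rS c k; apply: (leq_trans ir).
  rewrite -(subnKC (nk : n <= k)); elim: (k - n) => [|j jn].
    by rewrite addn0.
  by rewrite addnS (leq_trans jn) // ltnW //; case: (rS c (n + j)).
have le_r c n : n <= (r c n).2.
  by elim: n => // n /leq_ltn_trans; apply; case: (rS c n).
(* Move [i] is committed by stage [i.+1], so the diagonal is the limit run along [c]. *)
pose D c i := (r c i.+1).1 i.
have Dr c n i : i < (r c n).2 -> D c i = (r c n).1 i.
  move=> ir; have [ni|ni] := leqP n i.+1; first exact: r_le.
  by apply/esym/r_le; [exact: ltnW|exact: le_r].
have fine_D c : fine_play (D c).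
  split; last by move=> n; have [_ rE] := fine_r c n.+1; exact: rE.
  split=> n; first by have [[entU _] _] := fine_r c n.+1; exact: entU.
  have [[_ decU] _] := fine_r c n.+2.
  have -> : D c n = (r c n.+2).1 n by apply: Dr; exact: leq_trans (le_r c n.+2).
  exact: decU.
have /choice[g gP] : forall c, exists a, outcome (D c) a.
  by move=> c; exact: outcome_ex.
have r_local c d n : mkseq c n = mkseq d n -> r c n = r d n.
  elim: n => // n IH; rewrite !mkseqS => /rcons_inj[/IH rE cdn].
  by rewrite /= rE cdn.
have g_split c d n : mkseq c n = mkseq d n -> c n = false -> d n = true ->
    g c <> g d.
  move=> cd cn dn; have [_ _ sep] := fP _ (fine_r c n).
  have rcS : (r c n.+1).1 = (f (r c n)).1.1 by rewrite /= cn.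
  have rdS : (r d n.+1).1 = (f (r c n)).1.2 by rewrite /= dn (r_local c d).
  apply: (sep (D c) (D d)) => // i ir; first by rewrite (Dr c n.+1) ?rcS.
  by rewrite (Dr d n.+1) ?rdS //= -(r_local c d).
have g_inj : injective g.
  move=> c d gcd; apply/funext => i; elim/ltn_ind: i => i cd.
  have {}cd : mkseq c i = mkseq d i by exact/eq_mkseqP.
  move: (g_split c d i cd) (g_split d c i (esym cd)).
  case: (c i); case: (d i) => //; first move=> _.
    by move=> /(_ erefl erefl) /(_ (esym gcd)).
  by move=> /(_ erefl erefl) /(_ gcd).
have g_cont : continuous g.
  (* The answer at inning [n] uses moves [0] to [n], which depend on [n.+1] bits of [c] only; it
     determines [n] bits of the outcome. *)
  move=> c W /nbhs_cantorP[n nW]; apply/nbhs_cantorP; exists n.+1 => d /= dc.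
  apply: nW => /=; have [[Xc Dc] [Xd Dd]] := (gP c, gP d).
  have [_ DE] := fine_D c; have [_ DE'] := fine_D d.
  apply: (separating (z := play (D c) n)) => //; last exact: DE.
  have -> : play (D c) n = play (D d) n; last exact: DE'.
  congr sigma; apply/eq_mkseqP => i ni.
  have ir : i < (r c n.+1).2 by exact: leq_trans (le_r c n.+1).
  by rewrite (Dr c n.+1) // (Dr d n.+1) (r_local d c).
have [Cn0 clC perfC] := range_cantor_perfect g_inj g_cont.
by exists (range g); split=> // _ [c _ <-]; case: (gP c).
Qed.
End PlayerI.

(** * Psi-spaces *)

Section PsiSpace.
Variables (N : eqType) (A : set (set N)).

Lemma nbhs_inl (n : N) (W : set (Psi A)) :
  nbhs (inl n : Psi A) W <-> W (inl n).
Proof. by split=> [/nbhs_singleton//|Wn]; apply/principal_filterP. Qed.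

Lemma psi_basicP (a : set_type A) (F : set N) (z : Psi A) :
  psi_basic a F z <->
  match z with inl n => (val a) n /\ ~ F n | inr b => b = a end.
Proof.
split; first by case=> [->|[n an <-]].
by case: z => [n an|b ->]; [right; exists n|left].
Qed.

Lemma cvg_inl (x : nat -> Psi A) (n : N) : x @ \oo --> (inl n : Psi A) ->
  \forall k \near \oo, x k = inl n.
Proof. by move=> /(_ [set inl n]); apply; apply/nbhs_inl. Qed.

(** A basic neighbourhood of [inr a] omits only finitely many nodes of [a], and the sequence
    eventually avoids each of them. *)
Lemma cvg_inr (x : nat -> Psi A) (a : set_type A) :
  (\forall k \near \oo, psi_basic a set0 (x k)) ->
  (forall n, \forall k \near \oo, x k <> inl n) -> x @ \oo --> (inr a : Psi A).
Proof.
move=> xa xn W [F /finite_seqP[s ->] FW].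
have xs : \forall k \near \oo, forall n, n \in s -> x k <> inl n.
  elim: s {FW} => [|n s IH]; first exact: nearW.
  apply: filterS2 (xn n) IH => k kn ks m.
  by rewrite in_cons => /predU1P[->|/ks].
apply: filterS2 xa xs => k /psi_basicP xk xks; apply: FW.
apply/psi_basicP; case: (x k) xk xks => // n [an _] ns; split=> // sn.
exact: ns sn _.
Qed.

Hypothesis adA : almost_disjoint A.

(** Closedness is where almost disjointness enters: any other [b] has a neighbourhood that drops its
    finite intersection with [a]. *)
Lemma psi_basic_clopen (a : set_type A) (F : set N) :
  finite_set F -> clopen (psi_basic a F).
Proof.
move=> finF; split.
  rewrite openE => -[n|b] /psi_basicP.
    by move=> /= anF; apply/nbhs_inl/psi_basicP.
  by move=> /= ->; exists F.
rewrite -openC openE => -[n|b] zNF; first exact/nbhs_inl.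
have ba : val b <> val a.
  by move=> /val_inj ba; apply: zNF; apply/psi_basicP.
exists (val b `&` val a); first by apply: adA.2 => //; exact: set_valP.
move=> [n|c] /psi_basicP => [[bn nba]|->] //.
by move=> /psi_basicP[an _]; apply: nba.
Qed.

Lemma psi_clopen_base (z : Psi A) (W : set (Psi A)) :
  nbhs z W -> exists S, [/\ clopen S, S z & S `<=` W].
Proof.
case: z => [n /nbhs_inl Wn|a [F finF FW]]; last first.
  by exists (psi_basic a F); split=> //; [exact: psi_basic_clopen|left].
exists [set inl n]; split=> // [|_ -> //]; split.
  by rewrite openE => _ ->; exact/nbhs_inl.
rewrite -openC openE => -[k|b] kNn; first exact/nbhs_inl.
exists [set n]; first exact: finite_set1.
by move=> [k|c] /psi_basicP [] // _ kn [/kn].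
Qed.

End PsiSpace.

(** * The branching family *)

Section BranchingFamily.
Variable X : set cantor_space.
Let Y := Psi (branches X).

Lemma branch_of (a : set_type (branches X)) : exists2 x, X x & val a = branch x.
Proof. by have [x Xx <-] := set_valP a; exists x. Qed.

Lemma branch_point_ex : exists point : cantor_space -> Y,
  forall x, X x -> exists2 a, point x = inr a & val a = branch x.
Proof.
suff /choice[point pointP] : forall x, exists z : Y,
    X x -> exists2 a, z = inr a & val a = branch x by exists point.
move=> x; have [Xx|NXx] := pselect (X x); last by exists (inl [::]) => /NXx.
have Bx : branch x \in branches X by apply/mem_set; exists x.
by exists (inr (SigSub Bx)) => _; exists (SigSub Bx).
Qed.

Definition cone (p : seq bool) : set Y := fun z =>
  match z with inl t => prefix p t | inr a => val a p end.

(** An equivalence relation with finitely many cells: nodes shorter than [n] are alone in their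
    cells, while all other nodes and the branches are sorted by their first [n] bits. *)
Definition level (n : nat) : set (Y * Y) :=
  [set uv | forall p, size p <= n -> cone p uv.1 <-> cone p uv.2].

Lemma near_level n (z : Y) : \forall w \near z, level n (w, z).
Proof.
case: z => [t|a]; first by apply/nbhs_inl => p.
have [x Xx ax] := branch_of a.
exists (mkseq x @` `I_n); first exact/finite_image/finite_II.
move=> [t|b] /psi_basicP => [[+ Nt]|-> p //]; rewrite ax => -[k _ tk] p pn /=.
rewrite -tk prefix_mkseq ax; have nk : n <= k.
  by rewrite leqNgt; apply/negP => kn; apply: Nt; exists k.
rewrite (leq_trans pn nk) /=; split=> [/eqP ->|/branchE <-//].
exact: branch_mkseq.
Qed.

Lemma level_entourage n : fin_entourage (level n).
Proof.
exists {ffun n.-bseq bool -> bool},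
  (fun z => [ffun p : n.-bseq bool => `[< cone p z >]]).
split=> [z|u v /ffunP uv p pn].
  apply: filterS (near_level n z) => w wz; apply/ffunP => p; rewrite !ffunE.
  by apply/asbool_equiv_eq/wz/size_bseq.
have := uv (Bseq pn); rewrite !ffunE; exact: asbool_eq_equiv.
Qed.

Lemma level_inl_inr n (t : seq bool) (a : set_type (branches X)) :
  level n (inl t, inr a) -> n <= size t.
Proof.
have [x _ ax] := branch_of a => /(_ (mkseq x n)).
rewrite size_mkseq => /(_ (leqnn n)).
case=> _ /=; rewrite ax => /(_ (branch_mkseq x n)) /size_prefix.
by rewrite size_mkseq.
Qed.

Lemma level_inl n (z : Y) (t : seq bool) :
  size t < n -> level n (z, inl t) -> z = inl t.
Proof.
case: z => [s|a] tn zt; last first.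
  have /level_inl_inr : level n (inl t, inr a).
    by move=> p pn; exact: iff_sym (zt p pn).
  by rewrite leqNgt tn.
congr inl; have st : size s <= size t.
  (* [take n s] must be a prefix of [t], which is shorter than [n]; so nothing was cut off and [s]
     is no longer than [t]. *)
  have := zt (take n s); rewrite size_take_min geq_minl => /(_ isT) [/=].
  rewrite prefix_take => /(_ isT) /size_prefix + _.
  rewrite size_take_min geq_min => /orP[|//].
  by rewrite leqNgt tn.
have := zt s (leq_trans st (ltnW tn)); have := zt t (ltnW tn).
rewrite /= !prefix_refl => -[_ /(_ isT) ts] [/(_ isT) + _].
rewrite prefixE take_oversize; last exact: size_prefix.
by move=> /eqP.
Qed.

(** Player II's nodes do not converge: their lengths are unbounded, which excludes a node as limit;
    they agree with [b] ever longer, which excludes branches other than [b]; and each of them is off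
    [b]. *)
Lemma semi_proximal_no_perfect : semi_proximal (branches X) ->
  ~ (exists C : set cantor_space,
       [/\ C `<=` X, C !=set0, closed C & isolated C = set0]).
Proof.
move=> [U semi] [C [CX C0 clC perfC]]; apply: semi.
have [point pointP] := branch_point_ex.
pose Z := with_uniformity U.
have cvg_point x : C x ->
    (fun n => inl (mkseq x n) : Z) @ \oo --> (point x : Z).
  move=> /CX /pointP[a -> ax].
  apply: (@cvg_inr _ _ (fun n => inl (mkseq x n)) a).
    apply: nearW => n; apply/psi_basicP; split=> //.
    by rewrite ax; exact: branch_mkseq.
  move=> t; exists (size t).+1 => // n /= tn [nt].
  by move: tn; rewrite -nt size_mkseq ltnn.
have [sigma sigmaP play] := @strategyII_ex Z C _ point cvg_point clC perfC C0.
exists sigma; split=> // V /play[b [p [Cb sigmaE Vb pP]]].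
move=> [[l]|/seteqP[/(_ (point b)) + _]]; last first.
  by apply=> n _; apply/xsectionP; rewrite sigmaE.
have -> : (fun n => sigma (mkseq V n.+1)) = (fun n => inl (p n)).
  exact/funext.
case: l => [t /cvg_inl[N _ Nt]|c cvg_c].
  have [+ _ _] := pP (maxn N (size t)).
  have [->] := Nt (maxn N (size t)) (leq_maxl _ _).
  by rewrite ltnNge leq_maxr.
have [y _ cy] := branch_of c.
have [N _ Nc] : \forall n \near \oo, psi_basic c set0 (inl (p n)).
  by apply: cvg_c; exists set0; first exact: finite_set0.
have py n : N <= n -> p n = mkseq y (size (p n)).
  by move=> /Nc /psi_basicP[+ _]; rewrite cy => /branchE.
have yb : y = b.
  apply/funext => i; pose n := maxn N i.+1.
  have [np _] := pP n; rewrite (py n (leq_maxl _ _)).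
  rewrite /mkseq -map_take take_iota (minn_idPl (ltnW np)).
  by move=> /eq_mkseqP -> //; exact: leq_maxr.
by have [_ + _] := pP N; rewrite -yb; apply; exact: py.
Qed.

Lemma no_perfect_totally_semi_proximal :
  ~ (exists C : set cantor_space,
       [/\ C `<=` X, C !=set0, closed C & isolated C = set0]) ->
  totally_semi_proximal (branches X).
Proof.
move=> noC; pose base := psi_clopen_base (branches_almost_disjoint X).
exists (fin_uniformity base); split.
  exact: fin_uniformity_totally_bounded.
move=> [sigma win]; apply: noC; have [point pointP] := branch_point_ex.
pose Z := with_uniformity (fin_uniformity base).
apply: (@perfect_outcomes Z X point level _ _ _ _ sigma win).
- split=> n; first exact: level_entourage.
  by move=> uv uvP p /leqW; exact: uvP.
- move=> x [t|a] xz ncvg; last first.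
    have [b Xb ab] := branch_of a; exists b => //.
    have [c -> cb] := pointP b Xb; congr inr; apply: val_inj.
    by rewrite cb.
  (* If the common point were a node [t], the levels beyond [size t] would make the play constantly
     [t], hence convergent. *)
  case: ncvg; exists (inl t) => W /nbhs_inl Wt.
  by exists (size t).+1 => // n /= tn; rewrite (level_inl tn (xz n)).
- move=> a /pointP[c -> ca].
  (* This is the partition into the branch [c] with all its nodes, and the rest. Inside the first
     cell the levels keep the play off each given node in the long run, so it converges to [c]. *)
  exists [set uv | `[< psi_basic c set0 uv.1 >] = `[< psi_basic c set0 uv.2 >]].
    exists bool, (fun z => `[< psi_basic c set0 z >]); split=> //.
    apply: locally_constant_clopen; apply: psi_basic_clopen => //.
    exact: branches_almost_disjoint.
  move=> x xc xB; apply: (@cvg_inr _ _ x c).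
    apply: filterS xB => n /=; rewrite [X in _ = X]asboolT; last by left.
    by move=> xn; apply/asboolP; rewrite xn.
  move=> t; exists (size t).+1 => // n /= tn xnt.
  have := xc n; rewrite xnt => /level_inl_inr.
  by rewrite leqNgt tn.
- move=> n z a b /pointP[c -> ca] /pointP[d -> db].
  move=> /(_ (mkseq a n)) + /(_ (mkseq a n)).
  rewrite size_mkseq => /(_ (leqnn n)).
  move=> [_ +] /(_ (leqnn n)) [+ _]; rewrite /= ca db.
  by move=> /(_ (branch_mkseq a n)) za /(_ za) /branchE; rewrite size_mkseq.
Qed.

End BranchingFamily.

Theorem proposition1 (X : set cantor_space) :
  [<-> ~ (exists C : set cantor_space,
            [/\ C `<=` X, C !=set0, closed C & isolated C = set0]);
       semi_proximal (branches X);
       totally_semi_proximal (branches X)].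
Proof.
have total_semi :
    totally_semi_proximal (branches X) -> semi_proximal (branches X).
  by move=> [U [_ semiU]]; exists U.
tfae.
- by move=> /no_perfect_totally_semi_proximal /total_semi.
- by move=> /semi_proximal_no_perfect /no_perfect_totally_semi_proximal.
- by move=> /total_semi /semi_proximal_no_perfect.
Qed.
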